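(* Let $R$ be a commutative Noetherian ring and let $\mathcal{F}=\{I_i\}_{i\in\mathbb{N}}$ be a filtration of $R$. If $\mathcal{F}$ is strongly persistent, then $\mathcal{F}$ is persistent.
   Context: $\mathbb{N}$ denotes the nonnegative integers. A filtration of a ring $R$ is a family of ideals $\{I_n\}_{n\in\mathbb{N}}$ of $R$ such that (i) $I_0=R$; (ii) $I_{n+1}\subseteq I_n$ for all $n\in\mathbb{N}$; (iii) $I_nI_m\subseteq I_{n+m}$ for all $n,m\in\mathbb{N}$. For ideals $A,B$ of $R$, $(A:B)=\{x\in R: xB\subseteq A\}$. A filtration $\{I_i\}_{i\in\mathbb{N}}$ is strongly persistent if $(I_{i+1}:I_1)=I_i$ for all $i\in\mathbb{N}$. It is persistent if $\mathrm{Ass}(R/I_i)\subseteq\mathrm{Ass}(R/I_{i+1})$ for all $i\in\mathbb{N}$, where $\mathrm{Ass}(R/I)$ is the set of prime ideals of the form $(I:h)$ with $h\in R$. *)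

(* Defs.v *)
From mathcomp Require Import all_boot all_algebra.
From mathcomp Require Import all_classical.

Set Implicit Arguments.
Unset Strict Implicit.
Unset Printing Implicit Defensive.

Import GRing.Theory.

Local Open Scope classical_set_scope.
Local Open Scope ring_scope.

(* The [idealr] of MathComp's ring_quotient is a proper ideal of a nonzero
   ring. Here the whole ring is an ideal, as I_0 = R requires, and the zero
   ring is allowed. *)
Definition ideal (R : comPzRingType) (I : set R) : Prop :=
  [/\ I 0,
      forall x y : R, I x -> I y -> I (x + y)
    & forall a x : R, I x -> I (a * x)].

Definition ideal_gen (R : comPzRingType) (A : set R) : set R :=
  smallest (@ideal R) A.

Definition ideal_mul (R : comPzRingType) (I J : set R) : set R :=
  ideal_gen [set x * y | x in I & y in J].

Definition noetherian (R : comPzRingType) : Prop :=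
  forall I : set R, ideal I -> exists s : seq R, I = ideal_gen [set` s].

Definition prime_ideal (R : comPzRingType) (P : set R) : Prop :=
  [/\ ideal P, P <> setT
    & forall x y : R, P (x * y) -> P x \/ P y].

Definition colon (R : comPzRingType) (A B : set R) : set R :=
  [set x | forall y : R, B y -> A (x * y)].

Definition colon_elt (R : comPzRingType) (A : set R) (h : R) : set R :=
  [set x | A (x * h)].

(* [Ass I] is Ass(R/I). *)
Definition Ass (R : comPzRingType) (I : set R) : set (set R) :=
  [set P | prime_ideal P /\ exists h : R, P = colon_elt I h].

Definition filtration (R : comPzRingType) (I : nat -> set R) : Prop :=
  [/\ forall n : nat, ideal (I n),
      I 0%N = setT,
      forall n : nat, I n.+1 `<=` I n
    & forall n m : nat, ideal_mul (I n) (I m) `<=` I (n + m)%N].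

Definition strongly_persistent (R : comPzRingType) (I : nat -> set R) : Prop :=
  forall i : nat, colon (I i.+1) (I 1%N) = I i.

Definition persistent (R : comPzRingType) (I : nat -> set R) : Prop :=
  forall i : nat, Ass (I i) `<=` Ass (I i.+1).

(* Main.v *)
Require Import Defs.
From mathcomp Require Import all_boot all_algebra.
From mathcomp Require Import all_classical.

(* Let P = (I_i : h) be prime, and let y_1, ..., y_k generate I_1. Since
   I_i = (I_(i+1) : I_1), P is the intersection of the ideals
   (I_(i+1) : h y_j). A prime ideal that is a finite intersection of ideals
   equals one of them, so P = (I_(i+1) : h y_j) for some j. *)

Import GRing.Theory.

Local Open Scope classical_set_scope.
Local Open Scope ring_scope.

Lemma ideal_colon_elt (R : comPzRingType) (A : set R) (h : R) :
  ideal A -> ideal (colon_elt A h).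
Proof.
case=> A0 AD AM; rewrite /colon_elt; split=> /= [|x y Ax Ay|a x Ax].
- by rewrite mul0r.
- by rewrite mulrDl; apply: AD.
- by rewrite -mulrA; apply: AM.
Qed.

Lemma ideal_gen_sub (R : comPzRingType) (A J : set R) :
  ideal J -> A `<=` J -> ideal_gen A `<=` J.
Proof. by move=> idJ AJ x; apply. Qed.

(** By induction on [s]: the empty intersection is the whole ring, which a proper [P] cannot
    contain. If [J y] has an element [a] outside [P], any [x] in the intersection over the tail
    gives [a * x] in [P], so [x] is in [P] by primality. *)
Lemma prime_ideal_sub_bigcap (R : comPzRingType) (T : eqType) (P : set R)
    (J : T -> set R) (s : seq T) :
  prime_ideal P -> (forall y, ideal (J y)) ->
  \bigcap_(y in [set` s]) J y `<=` P -> exists2 y, y \in s & J y `<=` P.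
Proof.
case=> -[P0 PD PM] PT Pprime idJ; elim: s => [|y s IHs] capP.
  by case: PT; apply/seteqP; split=> // x _; apply: capP.
have [JyP|/existsNP[a /not_implyP[Ja nPa]]] := pselect (J y `<=` P).
  by exists y; rewrite ?mem_head.
case: IHs => [x capx|z zs JzP]; last by exists z; rewrite // inE zs orbT.
have /Pprime[/nPa//|//] : P (a * x).
apply: capP => z /=; rewrite inE => /orP[/eqP->|zs].
- by case: (idJ y) => _ _ JM; rewrite mulrC; apply: JM.
- by case: (idJ z) => _ _ JM; apply/JM/capx.
Qed.

Theorem corollary3p11 (R : comPzRingType) (I : nat -> set R)
    (noethR : noetherian R) (filtI : filtration I) :
  strongly_persistent I -> persistent I.
Proof.
case: filtI => idI _ _ _ strongI i P [primeP [h defP]].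
have [s defI1] := noethR _ (idI 1%N).
have [y ys subP] : exists2 y, y \in s & colon_elt (I i.+1) (h * y) `<=` P.
  apply: prime_ideal_sub_bigcap => // [y|x capx]; first exact: ideal_colon_elt.
  rewrite defP /colon_elt /= -strongI => y; rewrite defI1 mulrC.
  (* The elements that multiply [x * h] into [I i.+1] form an ideal, so testing the generators of
     [I 1] suffices. *)
  apply: (@ideal_gen_sub _ _ (colon_elt (I i.+1) (x * h))).
    exact: ideal_colon_elt.
  by move=> z /capx; rewrite /colon_elt /= mulrA mulrC.
split=> //; exists (h * y); apply/seteqP; split=> // x.
(* For [x] in [P], [x * h] lies in [I i], hence multiplies [y], an element of [I 1], into
   [I i.+1]. *)
rewrite defP /colon_elt /= -strongI mulrA; apply.
by rewrite defI1 => J [_]; apply.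
Qed.
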